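(* Let $K$ be a downward isotone cone in a Banach space $X$ that induces a partial order $\succcurlyeq$ on $X$. Let $f:K\to X$ be a mapping. Suppose that the following conditions are satisfied: a) $(X,\succcurlyeq)$ is re-chain-complete; b) for every $x\in X$, $P_K(x)$ is universally re-inductive in $(X,\succcurlyeq)$; c) $f$ is $\succcurlyeq$-increasing; d) there is $y_*\in K$ such that $f(y_* )\preccurlyeq y_*$. Then $f$ has a best approximation point on $K$. Moreover, $(\mathcal{B}(f)\cap(y_*],\succcurlyeq)$ is a nonempty re-inductive poset. Consequently, $f$ has an $\succcurlyeq$-minimal best approximation point $x^*$ on $K$ satisfying $x^*\preccurlyeq y_*$.
   Context: Banach spaces are real. A nonempty closed convex cone $K\subseteq X$ induces the order $x\succcurlyeq y$ (equivalently $y\preccurlyeq x$) iff $x-y\in K$, which is a partial order (so $K\cap(-K)=\{0\}$). The metric projection is $P_K(x)=\{x'\in K:\|x-x'\|=\inf_{z\in K}\|x-z\|\}$. $K$ is a downward isotone cone if it is a nonempty closed convex cone such that $P_K(x)\neq\emptyset$ for every $x\in X$ and $P_K$ is $\succcurlyeq$-increasing downward, i.e. whenever $x\preccurlyeq y$ in $X$ and $w\in P_K(y)$, there is $z\in P_K(x)$ with $z\preccurlyeq w$. A chain is a nonempty totally ordered subset. The partially ordered Banach space $(X,\succcurlyeq)$ is re-chain-complete if every chain in $X$ that has a lower bound has a greatest lower bound in $X$. A poset is re-inductive if every chain in it has a lower bound in it. A nonempty subset $A\subseteq X$ is universally re-inductive in $X$ if, for every chain $\{x_\alpha\}\subseteq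 X$ such that for every element $x_\beta$ of the chain there is $a\in A$ with $a\preccurlyeq x_\beta$, the chain has a lower bound belonging to $A$. The mapping $f$ is $\succcurlyeq$-increasing if $x\preccurlyeq y$ in $K$ implies $f(x)\preccurlyeq f(y)$. A point $x_0\in K$ is a best approximation point for $f$ on $K$ if $x_0\in P_K(f(x_0))$, i.e. $\|f(x_0)-x_0\|=\inf_{z\in K}\|f(x_0)-z\|$; $\mathcal{B}(f)$ is the set of all such points, and an $\succcurlyeq$-minimal best approximation point is a minimal element of $\mathcal{B}(f)$. $(y]=\{x\in X:x\preccurlyeq y\}$. *)

(* Defs.v *)
From HB Require Import structures.
From mathcomp Require Import all_boot all_order all_algebra.
From mathcomp Require Import all_classical all_reals all_analysis.

Set Implicit Arguments.
Unset Strict Implicit.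
Unset Printing Implicit Defensive.

Import Order.TTheory GRing.Theory Num.Theory.
Import numFieldNormedType.Exports.

Local Open Scope classical_set_scope.
Local Open Scope ring_scope.

Section Posets.
Variables (T : Type) (le : T -> T -> Prop).
Implicit Types A C : set T.

Definition poset_on A : Prop :=
  [/\ forall x, A x -> le x x,
      forall x y, A x -> A y -> le x y -> le y x -> x = y
    & forall x y z, A x -> A y -> A z -> le x y -> le y z -> le x z].

Definition is_chain C : Prop := C !=set0 /\ total_on C le.

Definition is_lower_bound C (b : T) : Prop := forall x, C x -> le b x.

Definition is_greatest_lower_bound C (b : T) : Prop :=
  is_lower_bound C b /\ forall b', is_lower_bound C b' -> le b' b.

Definition minimal_in A (m : T) : Prop :=
  A m /\ forall x, A x -> le x m -> x = m.

Definition down_set (y : T) : set T := [set x | le x y].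

Definition re_chain_complete : Prop :=
  forall C, is_chain C -> (exists b, is_lower_bound C b) ->
    exists b, is_greatest_lower_bound C b.

Definition re_inductive A : Prop :=
  forall C, C `<=` A -> is_chain C -> exists2 b, A b & is_lower_bound C b.

Definition universally_re_inductive A : Prop :=
  A !=set0 /\
  forall C, is_chain C -> (forall x, C x -> exists2 a, A a & le a x) ->
    exists2 b, A b & is_lower_bound C b.

End Posets.

Section Cones.
Variables (R : realType) (X : completeNormedModType R).
Implicit Types (K : set X) (f : X -> X).

Definition closed_convex_cone K : Prop :=
  [/\ K !=set0, closed K, convex_set K
    & forall (t : R) x, 0 <= t -> K x -> K (t *: x)].

(* [cone_le K x y] is x ≼ y. *)
Definition cone_le K (x y : X) : Prop := K (y - x).

Definition metric_proj K (x : X) : set X :=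
  [set x' | K x' /\ `|x - x'| = inf [set `|x - z| | z in K]].

Definition increasing_downward K (F : X -> set X) : Prop :=
  forall x y w, cone_le K x y -> F y w -> exists2 z, F x z & cone_le K z w.

Definition downward_isotone_cone K : Prop :=
  [/\ closed_convex_cone K,
      forall x, metric_proj K x !=set0
    & increasing_downward K (metric_proj K)].

(* A mapping K -> X is represented by a total f : X -> X; the definitions below
   only use the values of f on K. *)

Definition increasing_on K f : Prop :=
  forall x y, K x -> K y -> cone_le K x y -> cone_le K (f x) (f y).

Definition best_approx K f : set X := [set x | K x /\ metric_proj K (f x) x].

End Cones.

(* Main.v *)
Require Import Defs.
From HB Require Import structures.
From mathcomp Require Import all_boot all_order all_algebra.
From mathcomp Require Import all_classical all_reals all_analysis.

(** The argument is order-theoretic and replaces the set-valued map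
    x |-> P_K(f x) by its post-fixed points, the points of [descent_set]: those
    x in K above some w in P_K(f x). Every best approximation point is one
    (take w = x), and ystar is one because ystar projects to itself, so isotonicity
    sends f ystar <= ystar to a point of P_K(f ystar) below ystar.

    Two facts carry the proof. First, w is again a post-fixed point, since f
    and then P_K can be applied to w <= x ([descent_step]); hence a minimal
    post-fixed point equals its own w, that is, it is a best approximation
    point, and it is a fortiori minimal among these
    ([minimal_descent_best_approx]). Secondly, a chain of post-fixed points has
    its greatest lower bound among the post-fixed points
    ([descent_chain_glb]): chains in K are bounded below by 0, and universal
    re-inductivity of P_K(f b) at the infimum b merges the projections found
    below the members of the chain into a single one, which lies below b.

    By Zorn's lemma every post-fixed point then has a best approximation point
    below it that is minimal among all of them. Applied to ystar this gives
    existence and minimality; applied to the infimum of a chain of best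
    approximation points below ystar it gives a lower bound of the required
    kind. *)

Set Implicit Arguments.
Unset Strict Implicit.
Unset Printing Implicit Defensive.

Local Open Scope classical_set_scope.
Local Open Scope ring_scope.

(** Zorn's lemma, applied to the part of [A] below [a] with the reversed order;
    an element minimal there is minimal in all of [A] by transitivity. *)
Lemma minimal_below (T : Type) (le : T -> T -> Prop) (A : set T) (a : T) :
    poset_on le setT -> re_inductive le A -> A a ->
  exists2 m, minimal_in le A m & le m a.
Proof.
move=> [le_refl le_anti le_trans] A_ind Aa.
pose S := {x : T | A x /\ le x a}.
have [||||[m [Am le_ma]] m_min] :=
    @Zorn S (fun x y => `[< le (sval y) (sval x) >]).
- by move=> x; apply/asboolP/le_refl.
- by move=> x y z /asboolP yx /asboolP zy; apply/asboolP/(le_trans _ (sval y)).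
- move=> [x px] [y py] /asboolP /= yx /asboolP /= xy.
  by apply: eq_exist; apply: le_anti.
- move=> C C_tot.
  have [[c Cc]|C0] := pselect (C !=set0); last first.
    have aS : A a /\ le a a by split=> //; apply: le_refl.
    by exists (exist _ a aS) => s Cs; case: C0; exists s.
  have [||b Ab b_lb] := A_ind (sval @` C).
  + by move=> _ [s _ <-]; have [] := svalP s.
  + split; first by exists (sval c), c.
    move=> _ _ [s Cs <-] [t Ct <-].
    by have [/asboolP|/asboolP] := C_tot s t Cs Ct; [right|left].
  + have le_ba : le b a.
      have [_ le_ca] := svalP c.
      by apply: le_trans le_ca => //; apply: b_lb; exists c.
    exists (exist _ b (conj Ab le_ba)) => s Cs; apply/asboolP.
    by apply: b_lb; exists s.
- exists m => //; split=> // x Ax le_xm.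
  have le_xa : le x a by apply: (le_trans _ m).
  by have /(congr1 sval) :=
    m_min (exist _ x (conj Ax le_xa)) (asboolT le_xm).
Qed.

Section Cone.
Variables (R : realType) (X : completeNormedModType R) (K : set X).

Lemma cone_ge0 (x : X) : cone_le K 0 x <-> K x.
Proof. by rewrite /cone_le GRing.subr0. Qed.

Lemma metric_proj_id (x : X) : K x -> metric_proj K x x.
Proof.
move=> Kx; split=> //; rewrite GRing.subrr Num.Theory.normr0.
have lb0 : lbound [set `|x - z| | z in K] 0.
  by move=> _ [z _ <-]; apply: Num.Theory.normr_ge0.
have mem0 : [set `|x - z| | z in K] 0.
  by exists x => //; rewrite GRing.subrr Num.Theory.normr0.
apply/eqP; rewrite Order.POrderTheory.eq_le; apply/andP; split.
  by apply: lb_le_inf => //; exists 0.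
by apply: ge_inf => //; exists 0.
Qed.

Definition descent_set (f : X -> X) : set X :=
  [set x | K x /\ exists2 w, metric_proj K (f x) w & cone_le K w x].

Variable f : X -> X.
Hypothesis K_order : poset_on (cone_le K) setT.

Lemma best_approx_descent : best_approx K f `<=` descent_set f.
Proof.
by move=> x [Kx Px]; split=> //; exists x => //; case: K_order => + _ _; apply.
Qed.

Hypothesis P_increasing : increasing_downward K (metric_proj K).
Hypothesis f_increasing : increasing_on K f.

Lemma descent_set_of_le (y : X) : K y -> cone_le K (f y) y -> descent_set f y.
Proof.
by move=> Ky fy; split=> //; apply: (P_increasing fy); apply: metric_proj_id.
Qed.

(** Since f w <= f x, isotonicity of P_K matches w, as a projection of f x,
    with a projection of f w below w. *)
Lemma descent_step (x w : X) :
    K x -> metric_proj K (f x) w -> cone_le K w x -> descent_set f w.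
Proof.
move=> Kx Pw wx; have Kw : K w by case: Pw.
by split=> //; apply: P_increasing Pw; apply: f_increasing.
Qed.

(** The projection w below a minimal x is itself in the descent set, so w = x. *)
Lemma minimal_descent_best_approx (m : X) :
    minimal_in (cone_le K) (descent_set f) m ->
  minimal_in (cone_le K) (best_approx K f) m.
Proof.
move=> [[Km [w Pw wm]] m_min]; split=> [|x Bx]; last first.
  by apply: m_min; apply: best_approx_descent.
have wE : w = m by apply: m_min => //; apply: descent_step Pw wm.
by split=> //; rewrite -{2}wE.
Qed.

Hypothesis X_complete : re_chain_complete (cone_le K).
Hypothesis proj_inductive :
  forall x : X, universally_re_inductive (cone_le K) (metric_proj K x).

(** At the infimum b, each member x of the chain dominates a point of
    P_K(f b), because f b <= f x; universal re-inductivity turns these into one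
    point of P_K(f b) that is a lower bound of the chain, hence below b. *)
Lemma descent_chain_glb (C : set X) :
    C `<=` descent_set f -> is_chain (cone_le K) C ->
  exists2 b, descent_set f b & is_greatest_lower_bound (cone_le K) C b.
Proof.
move=> CD C_chain; have [_ _ le_trans] := K_order.
have lb0 : is_lower_bound (cone_le K) C 0.
  by move=> x /CD [Kx _]; apply/cone_ge0.
have [b [b_lb b_glb]] := X_complete C_chain (ex_intro _ 0 lb0).
have Kb : K b by apply/cone_ge0/b_glb.
exists b => //; split=> //.
have [|z Pz z_lb] := (proj_inductive (f b)).2 C C_chain; last first.
  by exists z => //; apply: b_glb.
move=> x Cx; have [Kx [w Pw wx]] := CD _ Cx.
have [z Pz zw] := P_increasing (f_increasing Kb Kx (b_lb _ Cx)) Pw.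
by exists z => //; apply: le_trans zw wx.
Qed.

Lemma minimal_best_approx_below (d : X) :
    descent_set f d ->
  exists2 m, minimal_in (cone_le K) (best_approx K f) m & cone_le K m d.
Proof.
move=> Dd; have [|m m_min md] := minimal_below K_order _ Dd; last first.
  by exists m => //; apply: minimal_descent_best_approx.
move=> C CD C_chain; have [b Db [b_lb _]] := descent_chain_glb CD C_chain.
by exists b.
Qed.

End Cone.

Theorem theorem6p1 (R : realType) (X : completeNormedModType R)
    (K : set X) (f : X -> X) (ystar : X)
    (K_isotone : downward_isotone_cone K)
    (K_order : poset_on (cone_le K) setT)
    (X_complete : re_chain_complete (cone_le K))
    (proj_inductive :
      forall x : X, universally_re_inductive (cone_le K) (metric_proj K x))
    (f_increasing : increasing_on K f)
    (K_ystar : K ystar)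
    (f_ystar : cone_le K (f ystar) ystar) :
  (best_approx K f !=set0) /\
  (let B := best_approx K f `&` down_set (cone_le K) ystar in
   [/\ B !=set0, poset_on (cone_le K) B & re_inductive (cone_le K) B]) /\
  (exists2 xstar : X,
     minimal_in (cone_le K) (best_approx K f) xstar & cone_le K xstar ystar).
Proof.
have [_ _ P_increasing] := K_isotone.
have [le_refl le_anti le_trans] := K_order.
have below := minimal_best_approx_below K_order P_increasing f_increasing
  X_complete proj_inductive.
have [m [Bm m_min] m_ystar] :=
  below _ (descent_set_of_le P_increasing K_ystar f_ystar).
split; [by exists m | split; last by exists m].
split=> [||C CB C_chain]; first by exists m.
  by split=> *; [apply: le_refl | apply: le_anti | apply: le_trans; eauto].
have CD : C `<=` descent_set K f.
  by move=> x /CB [Bx _]; apply: best_approx_descent.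
have [b Db [b_lb _]] := descent_chain_glb K_order P_increasing f_increasing
  X_complete proj_inductive CD C_chain.
have [n [Bn _] nb] := below b Db.
have n_lb : is_lower_bound (cone_le K) C n.
  by move=> x Cx; apply: le_trans nb (b_lb x Cx).
exists n => //; split=> //; have [[c Cc] _] := C_chain.
by have [_ cy] := CB _ Cc; apply: le_trans (n_lb _ Cc) cy.
Qed.
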